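(* The axiomatisation KD4 is sound with respect to social network models: every instance of axioms A1, A2, D, A4 is satisfied in every SNM; for every SNM $\mathit{SN}$, if $\mathit{SN}\vDash\phi$ and $\mathit{SN}\vDash\phi\Rightarrow\psi$ then $\mathit{SN}\vDash\psi$; and if $\phi$ is provable from no assumptions then $\mathit{SN}\vDash K_i\phi$ for every SNM $\mathit{SN}$ and agent $i$.
   Context: The logic $\mathcal{KBL}$: formulas $\phi ::= c_m(i,j)\mid a_n(i,j)\mid p(\vec t)\mid \phi\wedge\phi\mid\neg\phi\mid\forall x.\phi\mid K_i\phi$, $i,j$ agents, $m$ a connection index, $n$ an action index. A social network model (SNM) $\langle Ag,\mathcal{A},\mathit{KB},\pi\rangle$ consists of a finite nonempty set of agents $Ag$, a first-order structure $\mathcal{A}$ with finite domain containing binary relations $C_m,A_n\subseteq Ag\times Ag$, a map $\mathit{KB}$ giving each agent $i$ (and a distinguished environment agent $e$) a finite set $\mathit{KB}_i$ of formulas, and privacy policies $\pi$ (irrelevant here). KD4 consists of: A1 all instances of first-order tautologies; A2 $(K_i\phi\wedge K_i(\phi\Rightarrow\psi))\Rightarrow K_i\psi$; D $\neg K_i\bot$; A4 $K_i\phi\Rightarrow K_iK_i\phi$; R1 from $\phi$ and $\phi\Rightarrow\psi$ infer $\psi$; R2 from $\phi$ infer $K_i\phi$ when $\phi$ is provable from no assumptions. $\Gamma\vdash\phi$ denotes derivability from premises $\Gamma$ in KD4. Knowledge bases satisfy knowledge consistency (if $\mathit{KB}_i\vdash\phi$ then $\mathit{KB}_i\nvdash\neg\phi$)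 and self-awareness (if $\mathit{KB}_i\vdash\phi$ then $\mathit{KB}_i\vdash K_i\phi$). Satisfaction: $\mathit{SN}\vDash p(\vec t)$ iff $p(\vec t)\in\mathit{KB}_e$; $c_m(i,j)$ iff $(i,j)\in C_m$; $a_n(i,j)$ iff $(i,j)\in A_n$; Boolean connectives as usual; $\forall x.\phi$ iff $\phi[v/x]$ holds for all $v$ in the domain; $\mathit{SN}\vDash K_i\phi$ iff $\mathit{KB}_i\vdash\phi$. *)

(* Defs.v *)
From mathcomp Require Import all_boot.
From mathcomp Require Import classical_sets cardinality.

Set Implicit Arguments.
Unset Strict Implicit.
Unset Printing Implicit Defensive.

Local Open Scope classical_set_scope.

(** A signature carries the agents and the domain of the first-order
    structure, because formulas mention both: agents in [c_m(i,j)], [a_n(i,j)]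
    and [K_i], domain elements after the instantiation [phi[v/x]] of a
    quantified variable.  Social network models are taken over a signature. *)
Record signature := Signature {
  agent : finType;
  dom : finType;
  conn : Type;
  action : Type;
  pred_sym : Type;
  arity : pred_sym -> nat;
  agent_gt0 : (0 < #|agent|)%N;
  dom_gt0 : (0 < #|dom|)%N
}.

(** Well-scoped de Bruijn syntax: [term L n] and [form L n] have their free
    variables among [0, ..., n-1], and variable [0] is the innermost one.
    Every domain element is a constant denoting itself.  There are no other
    closed terms: atoms are evaluated by literal membership in a knowledge
    base, so a compound closed term would have to be identified with its value
    for [forall x. phi] to entail [phi[t/x]]. *)
Inductive term (L : signature) (n : nat) : Type :=
| Var of 'I_n
| Cst of dom L.

Arguments Var {L n} _.
Arguments Cst {L n} _.

Inductive form (L : signature) (n : nat) : Type :=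
| Conn of conn L & agent L & agent L
| Act of action L & agent L & agent L
| Pred (p : pred_sym L) of (arity p).-tuple (term L n)
| And of form L n & form L n
| Not of form L n
| All of form L n.+1
| Know of agent L & form L n.

Arguments Conn {L n} _ _ _.
Arguments Act {L n} _ _ _.
Arguments Pred {L n} _ _.

Notation sentence L := (form L 0).

Definition Imp L n (phi psi : form L n) : form L n := Not (And phi (Not psi)).

(** The grammar has no primitive falsum; any [chi /\ ~ chi] serves as one. *)
Definition Bot L n (chi : form L n) : form L n := And chi (Not chi).

Definition scons (T : Type) (n : nat) (v : T) (f : 'I_n -> T) (x : 'I_n.+1) : T :=
  if unlift ord0 x is Some y then f y else v.

Definition tsubst L n m (s : 'I_n -> term L m) (t : term L n) : term L m :=
  match t with Var x => s x | Cst d => Cst d end.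

Definition tshift L n : term L n -> term L n.+1 :=
  tsubst (fun x => Var (lift ord0 x)).

Definition up L n m (s : 'I_n -> term L m) : 'I_n.+1 -> term L m.+1 :=
  scons (Var ord0) (fun x => tshift (s x)).

Fixpoint fsubst L n (phi : form L n) {struct phi} :
    forall m, ('I_n -> term L m) -> form L m :=
  match phi with
  | Conn c i j => fun m _ => Conn c i j
  | Act a i j => fun m _ => Act a i j
  | Pred p t => fun m s => Pred p (map_tuple (tsubst s) t)
  | And phi psi => fun m s => And (fsubst phi s) (fsubst psi s)
  | Not phi => fun m s => Not (fsubst phi s)
  | All phi => fun m s => All (fsubst phi (up s))
  | Know i phi => fun m s => Know i (fsubst phi s)
  end.

Definition close L n (phi : form L n) (rho : 'I_n -> dom L) : sentence L :=
  fsubst phi (fun x => Cst (rho x)).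

Definition inst1 L (phi : form L 1) (v : dom L) : sentence L :=
  fsubst phi (fun=> Cst v).

Definition noenv (T : Type) (x : 'I_0) : T :=
  match notF (ltn_ord x) with end.
Arguments noenv {T} x.

(** Pure first-order schemas.  [FPred a k] is the [k]-th predicate letter of
    arity [a]; the constants are uninterpreted names. *)
Inductive fo (L : signature) (n : nat) : Type :=
| FPred (a k : nat) of a.-tuple (term L n)
| FAnd of fo L n & fo L n
| FNot of fo L n
| FAll of fo L n.+1.

Arguments FPred {L n} a k _.

Section FirstOrderSemantics.
Variables (L : signature) (U : Type) (c : dom L -> U).
Variable I : forall a : nat, nat -> a.-tuple U -> Prop.

Definition teval n (rho : 'I_n -> U) (t : term L n) : U :=
  match t with Var x => rho x | Cst d => c d end.

Fixpoint fo_sat n (theta : fo L n) : ('I_n -> U) -> Prop :=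
  match theta with
  | FPred a k t => fun rho => @I a k (map_tuple (teval rho) t)
  | FAnd th1 th2 => fun rho => fo_sat th1 rho /\ fo_sat th2 rho
  | FNot th => fun rho => ~ fo_sat th rho
  | FAll th => fun rho => forall u, fo_sat th (scons u rho)
  end.

End FirstOrderSemantics.

(** Truth in every nonempty structure, of any cardinality; constants may be
    interpreted by arbitrary elements. *)
Definition fo_valid L (theta : fo L 0) : Prop :=
  forall (U : Type) (c : dom L -> U)
         (I : forall a : nat, nat -> a.-tuple U -> Prop),
    inhabited U -> fo_sat c I theta noenv.

(** Replaces each [a]-ary letter by a formula with [a] argument places, which
    may contain the modalities. *)
Fixpoint fo_inst L (sigma : forall a : nat, nat -> form L a) n (theta : fo L n)
    : form L n :=
  match theta with
  | FPred a k t => fsubst (sigma a k) (tnth t)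
  | FAnd th1 th2 => And (fo_inst sigma th1) (fo_inst sigma th2)
  | FNot th => Not (fo_inst sigma th)
  | FAll th => All (fo_inst sigma th)
  end.

Inductive KD4_axiom (L : signature) : sentence L -> Prop :=
| ax_A1 (theta : fo L 0) (sigma : forall a : nat, nat -> form L a) :
    fo_valid theta -> KD4_axiom (fo_inst sigma theta)
| ax_A2 i (phi psi : sentence L) :
    KD4_axiom (Imp (And (Know i phi) (Know i (Imp phi psi))) (Know i psi))
| ax_D i (chi : sentence L) :
    KD4_axiom (Not (Know i (Bot chi)))
| ax_A4 i (phi : sentence L) :
    KD4_axiom (Imp (Know i phi) (Know i (Know i phi))).

(** Derivations are made of sentences.  Open formulas would not prove more
    sentences: there is no generalisation rule, and replacing free variables by
    a constant turns axioms and rule applications into axioms and rule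
    applications. *)
Inductive derivable (L : signature) (Gamma : set (sentence L))
    : sentence L -> Prop :=
| der_prem phi : Gamma phi -> derivable Gamma phi
| der_ax phi : KD4_axiom phi -> derivable Gamma phi
| der_R1 phi psi :
    derivable Gamma phi -> derivable Gamma (Imp phi psi) -> derivable Gamma psi
| der_R2 i phi : derivable set0 phi -> derivable Gamma (Know i phi).

(** The environment agent is not an element of [agent L]: it has a knowledge
    base but no modality.  Privacy policies play no role in satisfaction and
    are left out. *)
Record snm (L : signature) := Snm {
  conn_rel : conn L -> set (agent L * agent L);
  act_rel : action L -> set (agent L * agent L);
  kb : agent L -> set (sentence L);
  kb_env : set (sentence L);
  kb_finite : forall i, finite_set (kb i);
  kb_env_finite : finite_set kb_env;
  kb_consistent : forall i phi,
    derivable (kb i) phi -> ~ derivable (kb i) (Not phi);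
  kb_self_aware : forall i phi,
    derivable (kb i) phi -> derivable (kb i) (Know i phi)
}.

(** [sat_env SN phi rho] is satisfaction of the sentence [close phi rho]; the
    delayed substitution makes the recursion structural.  [sat_All] below
    recovers the clause for quantifiers in terms of [phi[v/x]]. *)
Fixpoint sat_env L (SN : snm L) n (phi : form L n) : ('I_n -> dom L) -> Prop :=
  match phi with
  | Conn c i j => fun _ => conn_rel SN c (i, j)
  | Act a i j => fun _ => act_rel SN a (i, j)
  | Pred p t => fun rho => kb_env SN (close (Pred p t) rho)
  | And phi psi => fun rho => sat_env SN phi rho /\ sat_env SN psi rho
  | Not phi => fun rho => ~ sat_env SN phi rho
  | All phi => fun rho => forall v, sat_env SN phi (scons v rho)
  | Know i phi => fun rho => derivable (kb SN i) (close phi rho)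
  end.

Definition sat L (SN : snm L) (phi : sentence L) : Prop := sat_env SN phi noenv.

Lemma eq_fsubst L n (phi : form L n) m (s s' : 'I_n -> term L m) :
  s =1 s' -> fsubst phi s = fsubst phi s'.
Proof.
elim: n / phi m s s' => [n c i j|n a i j|n p t|n phi IH1 psi IH2|n phi IH
  |n phi IH|n i phi IH] m s s' ss' //=.
- by congr Pred; apply: eq_from_tnth => x; rewrite !tnth_map; case: (tnth t x).
- by rewrite (IH1 _ _ _ ss') (IH2 _ _ _ ss').
- by rewrite (IH _ _ _ ss').
- congr All; apply: IH => x; rewrite /up /scons.
  by case: (unlift ord0 x) => // y; rewrite ss'.
- by rewrite (IH _ _ _ ss').
Qed.

Lemma fsubst_id L n (phi : form L n) (s : 'I_n -> term L n) :
  s =1 Var -> fsubst phi s = phi.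
Proof.
elim: n / phi s => [n c i j|n a i j|n p t|n phi IH1 psi IH2|n phi IH
  |n phi IH|n i phi IH] s s1 //=.
- by congr Pred; apply: eq_from_tnth => x; rewrite !tnth_map;
    case: (tnth t x) => //= y; rewrite s1.
- by rewrite IH1 ?IH2.
- by rewrite IH.
- congr All; apply: IH => x; rewrite /up /scons.
  by case: unliftP => [y|] -> //; rewrite s1.
- by rewrite IH.
Qed.

Lemma tsubst_up L n m k (s : 'I_n -> term L m) (s' : 'I_m -> term L k)
    (x : 'I_n.+1) :
  tsubst (up s') (up s x) = up (fun y => tsubst s' (s y)) x.
Proof.
rewrite /up {2 3}/scons; case: (unlift ord0 x) => [y|] /=; last first.
  by rewrite /scons unlift_none.
by case: (s y) => //= z; rewrite /scons liftK.
Qed.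

Lemma fsubst_comp L n (phi : form L n) m k (s : 'I_n -> term L m)
    (s' : 'I_m -> term L k) :
  fsubst (fsubst phi s) s' = fsubst phi (fun x => tsubst s' (s x)).
Proof.
elim: n / phi m k s s' => [n c i j|n a i j|n p t|n phi IH1 psi IH2|n phi IH
  |n phi IH|n i phi IH] m k s s' //=.
- by congr Pred; apply: eq_from_tnth => x; rewrite !tnth_map;
    case: (tnth t x).
- by rewrite IH1 IH2.
- by rewrite IH.
- congr All; rewrite IH; apply: eq_fsubst => x; exact: tsubst_up.
- by rewrite IH.
Qed.

Lemma sat_env_subst L (SN : snm L) n (phi : form L n) m (s : 'I_n -> term L m)
    (rho : 'I_m -> dom L) (rho' : 'I_n -> dom L) :
  (forall x, tsubst (fun y => @Cst L 0 (rho y)) (s x) = Cst (rho' x)) ->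
  sat_env SN (fsubst phi s) rho <-> sat_env SN phi rho'.
Proof.
elim: n / phi m s rho rho' => [n c i j|n a i j|n p t|n phi IH1 psi IH2|n phi IH
  |n phi IH|n i phi IH] m s rho rho' srho //=.
- suff -> : close (Pred p (map_tuple (tsubst s) t)) rho
    = close (Pred p t) rho' by [].
  rewrite -[Pred p (map_tuple _ _)]/(fsubst (Pred p t) s) /close fsubst_comp.
  exact: eq_fsubst.
- by rewrite (IH1 _ _ _ _ srho) (IH2 _ _ _ _ srho).
- by rewrite (IH _ _ _ _ srho).
- split=> H v; move: (H v); (rewrite IH; first by apply) => x;
    rewrite /up /scons; case: (unlift ord0 x) => [y|] /=;
    rewrite ?unlift_none //; move: (srho y); case: (s y) => //= z;
    by rewrite liftK.
- suff -> : close (fsubst phi s) rho = close phi rho' by [].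
  by rewrite /close fsubst_comp; exact: eq_fsubst.
Qed.

Lemma sat_Pred L (SN : snm L) (p : pred_sym L) t :
  sat SN (Pred p t) <-> kb_env SN (Pred p t).
Proof.
by rewrite /sat /= /close fsubst_id // => -[].
Qed.

Lemma sat_All L (SN : snm L) (phi : form L 1) :
  sat SN (All phi) <-> forall v, sat SN (inst1 phi v).
Proof.
have E v : sat SN (inst1 phi v) <-> sat_env SN phi (scons v noenv).
  apply: sat_env_subst => x.
  by rewrite /scons; case: unliftP => [[]|].
by split=> H v; apply/E; exact: H.
Qed.

Lemma sat_Know L (SN : snm L) i (phi : sentence L) :
  sat SN (Know i phi) <-> derivable (kb SN i) phi.
Proof.
by rewrite /sat /= /close fsubst_id // => -[].
Qed.

(* Main.v *)
Require Import Defs.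
From mathcomp Require Import all_boot.
From mathcomp Require Import classical_sets cardinality.
From mathcomp Require Import boolp.

(** For A1, a model is turned into a first-order structure over its domain in
    which a predicate letter holds of a tuple when the formula substituted for
    it is satisfied at that tuple; the modalities hidden in the substituted
    formulas are thereby opaque.  A2 and A4 are modus ponens and self-awareness
    inside a knowledge base, D is knowledge consistency against the tautology
    [~ (chi /\ ~ chi)], and necessitation is monotonicity of derivability in
    the premises. *)

Lemma sat_fo_inst (L : signature) (SN : snm L)
    (sigma : forall a : nat, nat -> form L a) n (theta : fo L n)
    (rho : 'I_n -> dom L) :
  sat_env SN (fo_inst sigma theta) rho <->
  fo_sat id (fun a k t => sat_env SN (sigma a k) (tnth t)) theta rho.
Proof.
elim: n / theta rho => [n a k t|n th1 IH1 th2 IH2|n th IH|n th IH] rho /=.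
- by apply: sat_env_subst => x; rewrite tnth_map; case: (tnth t x).
- by rewrite IH1 IH2.
- by rewrite IH.
- by split=> H v; apply/IH; exact: H.
Qed.

Lemma sat_Imp (L : signature) (SN : snm L) (phi psi : sentence L) :
  sat SN (Imp phi psi) <-> (sat SN phi -> sat SN psi).
Proof.
split=> [H satphi|H [satphi]]; last by apply; exact: H.
(* [Imp] is coded by [Not] and [And], so this direction is classical. *)
by apply: contrapT => nsat; exact: H.
Qed.

Lemma derivable_mono (L : signature) (Gamma Delta : set (sentence L))
    (phi : sentence L) :
  (Gamma `<=` Delta)%classic -> derivable Gamma phi -> derivable Delta phi.
Proof.
move=> sub D; elim: D Delta sub => {Gamma phi}.
- by move=> Gamma phi Gphi Delta sub; apply/der_prem/sub.
- by move=> Gamma phi ax Delta _; exact: der_ax.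
- move=> Gamma phi psi _ IH1 _ IH2 Delta sub.
  by apply: der_R1 (IH1 _ sub) (IH2 _ sub).
(* The premise of R2 is derived from [set0], so it is reused unchanged. *)
- by move=> Gamma i phi D _ Delta _; exact: der_R2.
Qed.

Lemma derivable_not_Bot (L : signature) (Gamma : set (sentence L))
    (chi : sentence L) : derivable Gamma (Not (Bot chi)).
Proof.
pose p : fo L 0 := FPred 0 0 [tuple].
(* The closed [chi] is weakened to every arity; at arity 0, the only one occurring in the schema,
   this is the identity. *)
pose sigma a (_ : nat) : form L a := fsubst chi noenv.
have <- : fo_inst sigma (FNot (FAnd p (FNot p))) = Not (Bot chi).
  by rewrite /= /sigma fsubst_comp fsubst_id // => -[].
by apply/der_ax/ax_A1 => U c I _ [].
Qed.

Lemma KD4_axiom_sat (L : signature) (SN : snm L) (phi : sentence L) :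
  KD4_axiom phi -> sat SN phi.
Proof.
case=> {phi} [theta sigma valid|i phi psi|i chi|i phi].
(* Validity covers only inhabited structures, so [d] witnesses that the domain is one. *)
- have [d _] := card_gt0P (dom_gt0 L).
  by apply/sat_fo_inst/valid; exact: inhabits d.
- apply/sat_Imp => -[/sat_Know Dphi /sat_Know Dimp].
  by apply/sat_Know; exact: der_R1 Dimp.
- by move/sat_Know/kb_consistent; apply; exact: derivable_not_Bot.
- by apply/sat_Imp => /sat_Know Dphi; apply/sat_Know; exact: kb_self_aware.
Qed.

Theorem theorem2 (L : signature) :
  (forall phi : sentence L, KD4_axiom phi -> forall SN : snm L, sat SN phi) /\
  (forall (SN : snm L) (phi psi : sentence L),
     sat SN phi -> sat SN (Imp phi psi) -> sat SN psi) /\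
  (forall phi : sentence L, derivable set0 phi ->
     forall (SN : snm L) (i : agent L), sat SN (Know i phi)).
Proof.
split; first by move=> phi ax SN; exact: KD4_axiom_sat.
split; first by move=> SN phi psi satphi /sat_Imp; exact.
move=> phi Dphi SN i; apply/sat_Know.
by apply: derivable_mono Dphi; exact: sub0set.
Qed.
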